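(* Let $\mathcal{G}$ be a causal graph (a finite directed acyclic graph) on nodes $\{1,\dots,d\}$ with adjacency matrix $\mathbf{A}$. Consider a VACA model over $\mathcal{G}$ whose decoder $p_\theta(\mathbf{X}\mid\mathbf{Z},\mathbf{A})$ is a message passing GNN. Let $\delta$ be the length of the longest shortest path between any two endogenous nodes of $\mathcal{G}$. Then VACA satisfies causal factorization, $p_\theta(\mathbf{X}\mid \mathbf{Z},\mathbf{A})=\prod_{i} p_{\theta_i}(X_i\mid \mathbf{Z}_{\mathrm{an}^*(i)})$, if and only if the number of hidden layers in the decoder is greater than or equal to $\delta-1$.
   Context: Graph notation. $\mathcal{G}$ is a finite directed acyclic graph on $\{1,\dots,d\}$, where node $i$ corresponds to the endogenous variable $X_i$. An edge $(j,i)$ means that $j$ is a parent of $i$. $\mathrm{pa}(i)=\mathcal{N}_i$ is the set of parents (also called neighbors) of $i$, and $\mathrm{pa}^*(i)=\mathrm{pa}(i)\cup\{i\}$. The causal adjacency matrix is $\mathbf{A}\in\{0,1\}^{d\times d}$ with $A_{ij}=1$ if $j\in\mathrm{pa}^*(i)$ and $A_{ij}=0$ otherwise. A path from $u$ to $v$ is an ordered sequence of distinct nodes $(u,w_1,\dots,w_{n-1},v)$ with an edge from each node to the next; its length is its number $n$ of edges. $\mathrm{an}(i)$ is the set of ancestors of $i$, i.e. nodes $j$ having a path to $i$, and $\mathrm{an}^*(i)=\mathrm{an}(i)\cup\{i\}$. For $u,v$ with at least one path from $u$ to $v$, $d^-(u,v)$ is the minimal length of a path from $u$ to $v$, and $\delta=\max_{u,v}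 d^-(u,v)$ over such pairs. Message passing GNN. A GNN with $L\ge 1$ layers has $N_h=L-1$ hidden layers. Given input features $h_i^0$ for each node $i$, layer $l=1,\dots,L$ computes, for every node $i$, $$h_i^l=f^u\big(h_i^{l-1},\,f^a(\{f^m(h_i^{l-1},h_j^{l-1};\theta_m^l): j\in\mathcal{N}_i\});\theta_u^l\big),$$ with message function $f^m$, aggregation function $f^a$ and update function $f^u$ (the functions may have node- or edge-specific parameters). The output for node $i$ is $h_i^L$. Dependence. Statements that an output ''is a function of'' an input, or does not depend on it, are understood at the level of the message passing computation: $h_i^l$ is a function of exactly the inputs $h_k^0$ with $k\in D_i^l$, where $D_i^0=\{i\}$ and $D_i^l=D_i^{l-1}\cup\bigcup_{j\in\mathcal{N}_i}D_j^{l-1}$. VACA. VACA over $\mathcal{G}$ has one latent variable $Z_i$ per node, with prior $p(\mathbf{Z})=\prod_i p(Z_i)$. Its decoder is a message passing GNN on $\mathcal{G}$ with input features $h_i^0=Z_i$, whose output at node $i$ gives the parameters $\boldsymbol{\eta}_i$ of the likelihood of $X_i$, so that $p_\theta(\mathbf{X}\mid\mathbf{Z},\mathbf{A})=\prod_i p_{\theta_i}(X_i;\boldsymbol{\eta}_i)$. VACA satisfies causal factorization if, for every $i$, $\boldsymbol{\eta}_i=\boldsymbol{\eta}_i(\mathbf{Z}_{\mathrm{an}^*(i)})$ is a function of all, and only, the latent features $Z_j$ with $j\in\mathrm{an}^*(i)$. *)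

(* Defs.v *)
From HB Require Import structures.
From mathcomp Require Import all_boot all_order all_algebra.
From mathcomp Require Import all_classical all_reals all_analysis.

Set Implicit Arguments.
Unset Strict Implicit.
Unset Printing Implicit Defensive.

Import Order.TTheory GRing.Theory Num.Theory.

(* MathComp-Analysis world.  The nodes 1, ..., d are the elements of 'I_d. *)

(* [edge G j i] means that j is a parent of i.  In path.v, [cycle e [::]] holds
   and [cycle e [:: x]] is [e x x], so self-loops are excluded too. *)
Record dag (d : nat) := Dag {
  edge : rel 'I_d;
  dag_acyclic : forall c : seq 'I_d, cycle edge c -> c = [::]
}.

Section Graph.
Variables (d : nat) (G : dag d).
Implicit Types u v i j : 'I_d.

Definition pa i : {set 'I_d} := [set j | edge G j i]%SET.
Definition pa_star i : {set 'I_d} := (i |: pa i)%SET.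

Definition adjacency_mx : 'M[nat]_d :=
  \matrix_(i, j) (if j \in pa_star i then 1%N else 0%N).

(* The path (u, w_1, ..., w_(n-1), v) is encoded by its start u and the n-tuple
   (w_1, ..., w_(n-1), v).  Paths have at least one edge; since their nodes are
   distinct, there is none from a node to itself. *)
Definition path_of_length u v (n : nat) : bool :=
  [exists w : n.-tuple 'I_d,
    [&& (0 < n)%N, path (edge G) u w, last u w == v & uniq (u :: w)]].

Definition has_path u v : bool := `[< exists n, path_of_length u v n >].

Definition an i : {set 'I_d} := [set j | has_path j i]%SET.
Definition an_star i : {set 'I_d} := (i |: an i)%SET.

(* d^-(u,v); the value 0 when there is no path is never used. *)
Definition dist u v : nat :=
  if pselect (exists n, path_of_length u v n) is left ex_path
  then ex_minn ex_path else 0%N.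

(* The maximum over an empty set of pairs (graph without edges) is 0. *)
Definition delta : nat :=
  \max_(uv : 'I_d * 'I_d | has_path uv.1 uv.2) dist uv.1 uv.2.

End Graph.

(* The diagonal of an adjacency matrix is 1, but i is not its own neighbor. *)
Definition neighbors (d : nat) (A : 'M[nat]_d) (i : 'I_d) : {set 'I_d} :=
  [set j | (j != i) && (A i j == 1%N)]%SET.

Lemma neighbors_adjacency (d : nat) (G : dag d) (i : 'I_d) :
  neighbors (adjacency_mx G) i = pa G i.
Proof.
apply/setP => j; rewrite !inE !mxE !inE; case: (eqVneq j i) => [->|_] /=.
  by case: (boolP (edge G i i)) => // Gii; have := @dag_acyclic _ G [:: i];
     rewrite /= Gii => /(_ isT).
by case: (edge G j i).
Qed.

(* [feature l i] is the space of h_i^l.  Layer l.+1 is computed by [gnn_msg l],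
   [gnn_aggr l] and [gnn_upd l]; the indices stand for the values of the
   parameters theta^(l.+1), which may be node- or edge-specific.  The
   aggregation is a function of the multiset of messages, i.e. a
   permutation-invariant function of a sequence.  The components beyond the
   last layer are irrelevant. *)
Record gnn (d : nat) (feature : nat -> 'I_d -> Type) := Gnn {
  n_hidden : nat;
  message : nat -> 'I_d -> eqType;
  aggregate : nat -> 'I_d -> Type;
  gnn_msg : forall l i j, feature l i -> feature l j -> message l i;
  gnn_aggr : forall l i, seq (message l i) -> aggregate l i;
  gnn_upd : forall l i, feature l i -> aggregate l i -> feature l.+1 i;
  gnn_aggr_perm : forall l i (s t : seq (message l i)),
    perm_eq s t -> gnn_aggr s = gnn_aggr t
}.

Arguments gnn_msg {d feature} _ {l} i j _ _.
Arguments gnn_aggr {d feature} _ {l i} _.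
Arguments gnn_upd {d feature} _ {l i} _ _.

Definition n_layers (d : nat) (feature : nat -> 'I_d -> Type)
  (N : gnn feature) : nat := (n_hidden N).+1.

Section MessagePassing.
Variables (d : nat) (feature : nat -> 'I_d -> Type).
Variables (N : gnn feature) (A : 'M[nat]_d).

Fixpoint gnn_state (h0 : forall i, feature 0 i) (l : nat) :
    forall i, feature l i :=
  if l is l'.+1 then
    let h := gnn_state h0 l' in
    fun i => gnn_upd N (h i)
      (gnn_aggr N [seq gnn_msg N i j (h i) (h j) | j <- enum (neighbors A i)])
  else h0.

Definition gnn_output (h0 : forall i, feature 0 i) :
  forall i, feature (n_layers N) i := gnn_state h0 (n_layers N).

End MessagePassing.

(* [input_nodes A l i] is D_i^l, the set of the k such that h_k^0 enters the
   message passing computation of h_i^l.  Whether an output depends on an input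
   is a property of this computation, not of the functions it composes (which
   could happen to ignore some of their arguments). *)
Fixpoint input_nodes (d : nat) (A : 'M[nat]_d) (l : nat) (i : 'I_d) :
    {set 'I_d} :=
  if l is l'.+1 then
    (input_nodes A l' i
       :|: \bigcup_(j in neighbors A i) input_nodes A l' j)%SET
  else [set i]%SET.

Record prob_density (R : realType) (disp : measure_display)
    (T : measurableType disp) (mu : {measure set T -> \bar R}%R) := ProbDensity {
  pdf :> T -> R;
  pdf_ge0 : forall x, (0 <= pdf x)%R;
  pdf_measurable : measurable_fun [set: T] pdf;
  pdf_integral : (\int[mu]_x (pdf x)%:E = 1)%E
}.

(* The inputs are the Z_i; layer l.+1 has its features in [hidden l]. *)
Definition layer_feature (d : nat) (latent : 'I_d -> Type)
    (hidden : nat -> 'I_d -> Type) (l : nat) (i : 'I_d) : Type :=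
  if l is l'.+1 then hidden l' i else latent i.

(* Z_i and X_i range over [latent i] and [obs i]; densities are relative to the
   reference measures [latent_ref i] and [obs_ref i], so that both continuous
   and discrete variables are covered.  The space of eta_i is the feature space
   of the last layer at node i. *)
Record vaca (R : realType) (d : nat) := Vaca {
  latent_disp : 'I_d -> measure_display;
  latent : forall i, measurableType (latent_disp i);
  latent_ref : forall i, {measure set (latent i) -> \bar R}%R;
  prior : forall i, prob_density (latent_ref i);
  layer_space : nat -> 'I_d -> Type;
  decoder : gnn (layer_feature (fun i => latent i : Type) layer_space);
  obs_disp : 'I_d -> measure_display;
  obs : forall i, measurableType (obs_disp i);
  obs_ref : forall i, {measure set (obs i) -> \bar R}%R;
  lik : forall i,
    layer_feature (fun i => latent i : Type) layer_space (n_layers decoder) i ->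
    prob_density (obs_ref i)
}.

Section Vaca.
Variables (R : realType) (d : nat) (V : vaca R d).

Definition lik_param (i : 'I_d) : Type :=
  layer_feature (fun i => latent V i : Type) (layer_space V)
    (n_layers (decoder V)) i.

Definition joint_prior (z : forall i, latent V i) : R :=
  (\prod_(i < d) prior V i (z i))%R.

Definition decoder_param (A : 'M[nat]_d) (z : forall i, latent V i)
  (i : 'I_d) : lik_param i := gnn_output (decoder V) A z i.

(* p_theta(x | z, A) *)
Definition likelihood (A : 'M[nat]_d) (x : forall i, obs V i)
    (z : forall i, latent V i) : R :=
  (\prod_(i < d) lik (decoder_param A z i) (x i))%R.

(* The first clause says that eta_i is a function of all, and only, the Z_j with
   j in an*(i); the other two exhibit eta_i as a function [eta i] of these Z_j
   alone, and the resulting factorization of the likelihood. *)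
Definition causal_factorization (G : dag d) : Prop :=
  let A := adjacency_mx G in
  (forall i, input_nodes A (n_layers (decoder V)) i = an_star G i) /\
  exists eta : forall i : 'I_d,
      (forall j : 'I_d, j \in an_star G i -> latent V j) -> lik_param i,
    (forall z i, decoder_param A z i = eta i (fun j _ => z j)) /\
    (forall x z, likelihood A x z =
       (\prod_(i < d) lik (eta i (fun j _ => z j)) (x i))%R).

End Vaca.

(* Main.v *)
(* D_i^l consists of the nodes from which i can be reached in at most l edges,
   because a walk can be shortened to a path.  Hence D_i^L = an*(i) for all i
   exactly when every d^-(u,v) is at most L = N_h + 1. *)
Require Import Defs.
From mathcomp Require Import all_boot all_order all_algebra.
From mathcomp Require Import all_classical all_reals all_analysis.

Import Order.TTheory GRing.Theory Num.Theory.

(** Walks may repeat nodes, unlike the paths of [path_of_length]. This lets the induction on [l]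
    append or remove the last edge freely: the union over the neighbors is the case of one more
    edge. *)
Lemma input_nodesP (d : nat) (G : dag d) (l : nat) (k i : 'I_d) :
  reflect (exists p, [/\ path (edge G) k p, last k p = i & (size p <= l)%N])
    (k \in input_nodes (adjacency_mx G) l i).
Proof.
elim: l i => [|l IHl] i /=.
  rewrite inE; apply: (iffP eqP) => [->|[p [_ <-]]]; first by exists [::].
  by rewrite leqn0 => /nilP ->.
rewrite inE neighbors_adjacency; apply: (iffP orP).
- case=> [/IHl [p [kp pi pl]]|/bigcupP [j]].
    by exists p; split=> //; apply: leqW.
  rewrite inE => ji /IHl [p [kp pj pl]]; exists (rcons p i).
  by rewrite rcons_path kp pj ji last_rcons size_rcons.
(* An empty walk forces [k = i], which is inherited from layer [l]. Otherwise the walk without its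
   last edge ends at a parent of [i]. *)
- case=> p; case/lastP: p => [|p x] [].
    by move=> _ /= <- _; left; apply/IHl; exists [::].
  rewrite rcons_path last_rcons size_rcons => /andP [kp ex] xi pl; right.
  rewrite -xi; apply/bigcupP; exists (last k p); first by rewrite inE.
  by apply/IHl; exists p.
Qed.

Lemma path_of_lengthP (d : nat) (G : dag d) (u v : 'I_d) (n : nat) :
  reflect (exists w, [/\ (0 < n)%N, size w = n, path (edge G) u w,
                         last u w = v & uniq (u :: w)])
    (path_of_length G u v n).
Proof.
apply: (iffP existsP) => [[w /and4P [n0 uw /eqP wv Uw]]|[w [n0 wn uw wv Uw]]].
  by exists w; rewrite size_tuple.
have /eqP wn' := wn; exists (Tuple wn').
by rewrite n0 uw wv eqxx Uw.
Qed.

Lemma path_of_length_neq {d : nat} {G : dag d} {u v : 'I_d} {n : nat} :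
  path_of_length G u v n -> u != v.
Proof.
case/path_of_lengthP => w [n0 wn _ <-].
case: w wn => [wn|x w _]; first by rewrite -wn in n0.
rewrite cons_uniq /= => /andP [uxw _].
by apply: contraNneq uxw => ->; rewrite mem_last.
Qed.

Lemma walk_path_of_length {d : nat} {G : dag d} {u v : 'I_d} {p : seq 'I_d} :
  u != v -> path (edge G) u p -> last u p = v ->
  exists2 n, path_of_length G u v n & (n <= size p)%N.
Proof.
move=> uv up pv.
case/shortenP: up pv => q uq Uq qp qv; exists (size q).
  apply/path_of_lengthP; exists q; split=> //.
  (* An empty [q] would give [u = v], so the shortened walk has an edge. *)
  by case: q qv {uq Uq qp} => //= uv'; rewrite uv' eqxx in uv.
by apply: uniq_leq_size => //; case/andP: Uq.
Qed.

Lemma dist_le {d : nat} {G : dag d} {u v : 'I_d} {n : nat} :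
  path_of_length G u v n -> (dist G u v <= n)%N.
Proof.
move=> uvn; rewrite /dist; case: pselect => [ex|[]]; last by exists n.
by case: ex_minnP => m _; apply.
Qed.

Lemma dist_path {d : nat} {G : dag d} {u v : 'I_d} :
  has_path G u v -> path_of_length G u v (dist G u v).
Proof.
move=> /asboolP uv; rewrite /dist; case: pselect => [ex|//].
by case: ex_minnP.
Qed.

Lemma input_nodes_sub_an_star (d : nat) (G : dag d) (l : nat) (i : 'I_d) :
  input_nodes (adjacency_mx G) l i \subset an_star G i.
Proof.
apply/fintype.subsetP => k /input_nodesP [p [kp pi _]].
rewrite !inE; case: eqVneq => //= ki; apply/asboolP.
by have [n kin _] := walk_path_of_length ki kp pi; exists n.
Qed.

Lemma input_nodes_eq_an_star (d : nat) (G : dag d) (l : nat) :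
  (forall i, input_nodes (adjacency_mx G) l i = an_star G i) <->
  (delta G <= l)%N.
Proof.
split=> [Dan|dl i].
(* The walk that puts [u] among the inputs of [v] has at most [l] edges; shortened to a path, it
   bounds the distance. *)
- apply/bigmax_leqP => -[u v] /= uv.
  have : u \in an_star G v by rewrite !inE uv orbT.
  rewrite -Dan => /input_nodesP [p [up pv pl]].
  have [n uvn np] :=
    walk_path_of_length (path_of_length_neq (dist_path uv)) up pv.
  exact: leq_trans (dist_le uvn) (leq_trans np pl).
- apply/eqP; rewrite finset.eqEsubset input_nodes_sub_an_star /=.
  apply/fintype.subsetP => k; rewrite !inE => /predU1P [->|ki].
    by apply/input_nodesP; exists [::].
  (* A shortest path from [k] to [i] is a walk with at most [delta G] edges. *)
  have /path_of_lengthP [w [_ wn kw wi _]] := dist_path ki.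
  apply/input_nodesP; exists w; split=> //; rewrite wn.
  apply: leq_trans dl.
  exact: (@leq_bigmax_cond _ _ (fun uv => dist G uv.1 uv.2) (k, i)).
Qed.

(** Links the syntactic sets of inputs to the computed values; this is what makes [eta] below well
    behaved. *)
Lemma gnn_state_ext (d : nat) (feature : nat -> 'I_d -> Type)
    (N : gnn feature) (A : 'M[nat]_d) (h h' : forall i, feature 0%N i)
    (l : nat) (i : 'I_d) :
  (forall k, k \in input_nodes A l i -> h k = h' k) ->
  gnn_state N A h l i = gnn_state N A h' l i.
Proof.
elim: l i => [|l IHl] i /= hh'; first by apply: hh'; rewrite inE.
have hi : gnn_state N A h l i = gnn_state N A h' l i.
  by apply: IHl => k ki; apply: hh'; rewrite inE ki.
rewrite hi; congr (gnn_upd _ _ (gnn_aggr _ _)).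
apply/eq_in_map => j; rewrite mem_enum => ji; rewrite (IHl j) // => k kj.
by apply: hh'; rewrite inE; apply/orP; right; apply/bigcupP; exists j.
Qed.

(** Over an empty space the integral of the density would be 0 instead of 1. *)
Lemma prob_density_inhabited {R : realType} {disp : measure_display}
    {T : measurableType disp} {mu : {measure set T -> \bar R}%R}
    (p : prob_density mu) : inhabited T.
Proof.
apply: contrapT => T0; have := pdf_integral p.
have -> : [set: T]%classic = set0.
  by apply/seteqP; split=> // x; case: T0.
by rewrite integral_set0 => /esym/eqP; rewrite onee_eq0.
Qed.

Theorem proposition1 (R : realType) (d : nat) (G : dag d) (V : vaca R d) :
  causal_factorization V G <->
  ((delta G)%:Z - 1 <= (n_hidden (decoder V))%:Z)%R.
Proof.
(* Over the integers [delta G = 0] causes no truncation; the bound becomes [delta G] at most the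
   number of layers. *)
rewrite lerBlDr -PoszD lez_nat addn1.
rewrite -/(n_layers (decoder V)) -input_nodes_eq_an_star.
split=> [[]//|Dan]; split=> //.
(* The arguments of eta lie in an*(i) only; evaluating the decoder needs values
   for the other latent variables, which exist because each prior has mass 1. *)
have z0 j : latent V j.
  have /cid [//] : exists z : latent V j, True.
  by have [z] := prob_density_inhabited (prior V j); exists z.
pose extend i (f : forall j, j \in an_star G i -> latent V j) j : latent V j :=
  if pselect (j \in an_star G i) is left ji then f j ji else z0 j.
pose eta i f := decoder_param (adjacency_mx G) (@extend i f) i.
have etaE z i :
    decoder_param (adjacency_mx G) z i = eta i (fun j _ => z j).
  (* By [Dan] every input that enters lies in an*(i), where [extend] returns the given value and not
     the default [z0]. *)
  apply: gnn_state_ext => k; rewrite Dan /extend => ki.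
  by case: pselect.
exists eta; split=> // x z.
by apply: eq_bigr => i _; rewrite etaE.
Qed.
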